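(* Let $\mathcal{S}$ be the family consisting of the spaces $\ell^\infty$, $c_0$, $\ell^p$ for $0<p<+\infty$, and $\bigcap_{p>a}\ell^p$ for $0\le a<+\infty$. Let $X,Y\in\mathcal{S}$ with $Y\neq\ell^\infty$, $X\subset Y$ and $X\neq Y$. Then there is algebraic genericity for the couple $(Y,X)$; that is, there exists a vector subspace $F$ of $Y$, dense in $Y$, such that $F\setminus\{0\}\subset Y\setminus X$.
   Context: All spaces are spaces of complex sequences $f=(f(n))_{n\ge1}$, with their natural complete metrizable vector space topologies: $\ell^\infty$ and $c_0$ carry the sup norm; $\ell^p$ for $1\le p<\infty$ carries the norm $\|f\|_p=(\sum_n|f(n)|^p)^{1/p}$; $\ell^p$ for $0<p<1$ carries the metric $d_p(f,g)=\sum_n|f(n)-g(n)|^p$; and $\bigcap_{p>a}\ell^p$ (intersection over all finite $p>a$) carries the metrizable topology in which $f_m\to f$ iff $f_m\to f$ in $\ell^p$ for every $p\in(a,+\infty)$. *)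

(* Defs.v *)
From HB Require Import structures.
From mathcomp Require Import all_boot all_order all_algebra.
From mathcomp Require Import complex.
From mathcomp Require Import all_classical all_reals all_analysis.
Import Order.TTheory GRing.Theory Num.Theory numFieldNormedType.Exports.
Import Normc.

Set Implicit Arguments.
Unset Strict Implicit.
Unset Printing Implicit Defensive.

Local Open Scope classical_set_scope.
Local Open Scope ring_scope.

(* Sequences are indexed from 0 instead of 1.  The codomain is R[i]^o because
   R[i] alone is not an R[i]-module, so the pointwise scaling by complex
   numbers would not be found. *)
Notation cseq R := (nat -> R[i]^o).

(* A name for each member of the family of spaces. *)
Inductive space_name (R : realType) : Type :=
| Linfty
| Czero
| Lp (p : R) of 0 < p
| Lcap (a : R) of 0 <= a.

Arguments Linfty {R}.
Arguments Czero {R}.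

Section sequence_spaces.
Context {R : realType}.
Implicit Types (f g : cseq R) (p : R) (X : space_name R).

Definition psum p f : \bar R := (\sum_(0 <= n <oo) (normc (f n) `^ p)%:E)%E.

Definition linfty : set (cseq R) := [set f | has_ubound (range (fun n => normc (f n)))].

Definition czero : set (cseq R) := [set f | f n @[n --> \oo] --> (0 : R[i]^o)].

Definition lp p : set (cseq R) := [set f | (psum p f < +oo)%E].

Definition carrier X : set (cseq R) :=
  match X with
  | Linfty => linfty
  | Czero => czero
  | Lp p _ => lp p
  | Lcap a _ => \bigcap_(p in [set p | a < p]) lp p
  end.

Definition supnorm f : R := sup (range (fun n => normc (f n))).

(* For 1 <= p this is the norm of l^p; for p < 1 it is the function such that
   lpmag p (f - g) is the distance of f and g in l^p. *)
Definition lpmag p f : R :=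
  if 1 <= p then fine (psum p f) `^ p^-1 else fine (psum p f).

(* The topology of each space is generated by the translation-invariant metrics
   (f, g) |-> N (f - g), with N in magnitudes X. *)
Definition magnitudes X : set (cseq R -> R) :=
  match X with
  | Linfty | Czero => [set supnorm]
  | Lp p _ => [set lpmag p]
  | Lcap a _ => [set lpmag p | p in [set p | a < p]]
  end.

Lemma psum_ge0 p f : (0 <= psum p f)%E.
Proof. by apply: nneseries_ge0 => n _ _; rewrite lee_fin powR_ge0. Qed.

Lemma powR_normcD p (a : R[i]) (u v : R[i]) : 0 <= p ->
  normc (a * u + v) `^ p <=
  2 `^ p * normc a `^ p * normc u `^ p + 2 `^ p * normc v `^ p.
Proof.
move=> p0.
have n0 (z : R[i]) : 0 <= normc z by case: z => x y; exact: sqrtr_ge0.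
pose m := Num.max (normc (a * u)) (normc v).
have m0 : 0 <= m by rewrite le_max n0.
have le2m : normc (a * u + v) <= 2 * m.
  apply: (le_trans (le_normcD _ _)); rewrite mulr_natl mulr2n.
  by apply: lerD; rewrite le_max lexx ?orbT.
apply: (le_trans (ge0_ler_powR p0 _ _ le2m)); rewrite ?nnegrE ?mulr_ge0//.
rewrite powRM// -mulrA -(powRM p (n0 a) (n0 u)) -normcM -mulrDr.
rewrite ler_wpM2l ?powR_ge0// /m.
by case: (leP (normc (a * u)) (normc v)) => _; [rewrite lerDr|rewrite lerDl];
  exact: powR_ge0.
Qed.

Lemma lp_closed p : 0 < p -> submod_closed [in lp p].
Proof.
move=> p0; split=> [|a u v].
  rewrite inE /lp /= /psum eseries0 ?ltry// => n _ _.
  by rewrite normc0 powR0 ?gt_eqF.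
rewrite !inE /lp /= => up vp.
pose c := 2 `^ p * normc a `^ p.
pose d : R := 2 `^ p.
apply: (@le_lt_trans _ _ (c%:E * psum p u + d%:E * psum p v)%E).
  rewrite -!nneseriesZl; try by move=> *; rewrite ?lee_fin ?mulr_ge0 ?powR_ge0.
  rewrite -nneseriesD; try by move=> *; rewrite ?lee_fin ?mule_ge0 ?lee_fin ?mulr_ge0 ?powR_ge0.
  apply: lee_nneseries => n _.
    by move=> _; rewrite lee_fin powR_ge0.
  by rewrite -!EFinM -EFinD lee_fin; exact/powR_normcD/ltW.
by apply: lte_add_pinfty; apply: lte_mul_pinfty; rewrite ?lee_fin ?mulr_ge0 ?powR_ge0.
Qed.

Lemma carrier_closed X : submod_closed [in carrier X].
Proof.
case: X => [||p p0|a a0] /=.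
- split=> [|a u v]; rewrite !inE.
    by exists 0 => _ [n _ <-]; rewrite [X in X <= _]normc0.
  move=> [M uM] [N vN]; exists (normc a * M + N) => _ [n _ <-] /=.
  apply: (le_trans (le_normcD _ _)); rewrite lerD//; last by apply: vN; exists n.
  rewrite normcM ler_wpM2l//; first by case: (a) => x y; exact: sqrtr_ge0.
  by apply: uM; exists n.
- split=> [|a u v]; rewrite !inE; first exact: cvg_cst.
  rewrite /czero /= => u0 v0; rewrite [X in _ --> X](_ : _ = a *: (0 : R[i]^o) + 0).
    exact: cvgD (cvgZr u0) v0.
  by rewrite scaler0 addr0.
- exact: lp_closed.
- split=> [|c u v]; rewrite !inE.
    move=> p /= ap; have /lp_closed[+ _] := le_lt_trans a0 ap.
    by rewrite inE.
  move=> uX vX p /= ap; have /lp_closed[_ /(_ c u v)] := le_lt_trans a0 ap.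
  by rewrite !inE; apply; [exact: uX|exact: vX].
Qed.

Definition in_space X : {pred cseq R} := [in carrier X].

HB.instance Definition _ X :=
  GRing.isSubmodClosed.Build R[i] (cseq R) (in_space X) (carrier_closed X).

Definition seqspace X : Type := {f : cseq R | f \in in_space X}.

HB.instance Definition _ X := SubChoice.on (seqspace X).
HB.instance Definition _ X := [SubChoice_isSubLmodule of seqspace X by <:].
HB.instance Definition _ X := isPointed.Build (seqspace X) 0.

Definition mball X (i : (cseq R -> R) * seqspace X * R) : set (seqspace X) :=
  [set g | i.1.1 (val g - val i.1.2) < i.2].

(* The open balls of the metrics of X form a subbase of its topology; for Lcap
   this is the coarsest topology making the inclusions in all l^p, a < p,
   continuous. *)
HB.instance Definition _ X := @isSubBaseTopological.Build (seqspace X)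
  ((cseq R -> R) * seqspace X * R)%type
  [set i | magnitudes X i.1.1 /\ 0 < i.2] (@mball X).

End sequence_spaces.

(* Main.v *)
Require Import Defs.
From mathcomp Require Import all_boot all_order all_algebra.
From mathcomp Require Import complex.
From mathcomp Require Import all_classical all_reals all_analysis.
Import Order.TTheory GRing.Theory Num.Theory numFieldNormedType.Exports.
Import Normc.

Set Implicit Arguments.
Unset Strict Implicit.
Unset Printing Implicit Defensive.

Local Open Scope classical_set_scope.
Local Open Scope ring_scope.

(* Take [w] in [Y] but not in [X], and let the [w_(k,n)] be copies of [w]
   supported on pairwise disjoint infinite sets of indices.  [F] is the span of
   the vectors [e_n + w_(k,n) / (k + 1)].
   All spaces are stable under restriction to an infinite set of indices and
   contain the finitely supported sequences, so restricting a combination that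
   lies in [X] to the support of [w_(k,n)] forces the coefficient of that
   vector to vanish.
   Letting [k] tend to infinity, the closure of [F] contains every [e_n], and
   indeed every finitely supported sequence; these are dense because [Y] is not
   [l^oo]. *)

Section family.
Context {R : realType}.
Implicit Types (f g h w : cseq R) (p r e : R) (X Y : space_name R).

(** * Membership in the spaces: criteria, restriction, finite support *)

Lemma normc_ge0 (z : R[i]) : 0 <= normc z.
Proof. by case: z => x y; exact: sqrtr_ge0. Qed.

Lemma psumE p f : psum p f = \esum_(n in [set: nat]) (normc (f n) `^ p)%:E.
Proof. by rewrite /psum nneseries_esumT// => n; rewrite lee_fin powR_ge0. Qed.

(** The terms of [f \o s] are those of [f] on the range of [s], each counted once, and all terms are
    nonnegative. *)
Lemma psum_comp_inj p f (s : nat -> nat) : injective s ->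
  (psum p (f \o s) <= psum p f)%E.
Proof.
move=> s_inj; rewrite !psumE.
rewrite -(esum_image [set: nat] s (fun n => (normc (f n) `^ p)%:E)); last first.
  by move=> x y _ _; exact: s_inj.
by rewrite esum_mkcond; apply: le_esum => i _; case: ifP;
  rewrite ?lee_fin ?powR_ge0.
Qed.

Lemma finite_nat_near (A : set nat) : finite_set A ->
  \forall n \near \oo, ~ A n.
Proof.
case/finite_seqP => B ->; exists (\max_(k <- B) k).+1 => // n /= Bn nB.
by have := @leq_bigmax_seq _ B xpredT id n nB isT; rewrite leqNgt Bn.
Qed.

Lemma near_finite_nat (A : set nat) : (\forall n \near \oo, ~ A n) ->
  finite_set A.
Proof.
case=> N _ NA; apply: (sub_finite_set _ (finite_II N)) => n /= An.
by rewrite ltnNge; apply/negP => /NA.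
Qed.

(** Finiteness of level sets is what passes easily through injections and through the encoding of
    triples by [pickle]. *)
Lemma CzeroP f : carrier Czero f <->
  forall e, 0 < e -> finite_set [set n | e <= normc (f n)].
Proof.
split=> [/cvgrPdist_lt f0 e e0|fin].
  have /f0 : 0 < e%:C%C :> R[i] by rewrite ltcR.
  move=> f0e; apply: near_finite_nat; apply: filterS f0e => n /=.
  rewrite sub0r normrN [ltLHS](_ : _ = (normc (f n))%:C%C)// ltcR.
  by move=> + en => /(le_lt_trans en); rewrite ltxx.
apply/cvgrPdist_lt => e e0.
(* In the order of [R[i]], a positive element is real. *)
have eE : e = (complex.Re e)%:C%C by apply/esym/RRe_real/gtr0_real.
have /fin : 0 < complex.Re e by rewrite eE ltcR in e0.
move/finite_nat_near; apply: filterS => n /= /negP; rewrite -ltNge => fne.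
by rewrite sub0r normrN [ltLHS](_ : _ = (normc (f n))%:C%C)// eE ltcR.
Qed.

Lemma LinftyP f :
  carrier Linfty f <-> exists M, forall n, normc (f n) <= M.
Proof.
split=> -[M fM]; exists M; first by move=> n; apply: fM; exists n.
by move=> _ [n _ <-].
Qed.

Lemma Czero_Linfty : carrier (@Czero R) `<=` carrier Linfty.
Proof.
move=> f /CzeroP /(_ _ ltr01) /finite_nat_near [N _ fN]; apply/LinftyP.
(* From [N] on the entries are below 1; each earlier one is at most the sum. *)
exists (\sum_(k < N) normc (f k) + 1) => n; have [Nn|nN] := leqP N n.
  have /negP := fN _ Nn; rewrite -ltNge => /ltW/le_trans; apply.
  by rewrite lerDr sumr_ge0// => *; exact: normc_ge0.
rewrite -[n]/(val (Ordinal nN)) (bigD1 (Ordinal nN))//= -addrA lerDl.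
by rewrite addr_ge0// sumr_ge0// => *; exact: normc_ge0.
Qed.

(** With [s] enumerating an infinite set of indices, this is stability under restriction to that
    set. *)
Lemma carrier_comp_inj X f (s : nat -> nat) : injective s ->
  carrier X f -> carrier X (f \o s).
Proof.
move=> s_inj; case: X => [||p p0|a a0].
- by move=> /LinftyP[M fM]; apply/LinftyP; exists M => n; exact: fM.
- move=> /CzeroP fin; apply/CzeroP => e /fin; apply: finite_preimage => x y _ _.
  exact: s_inj.
- exact/le_lt_trans/psum_comp_inj.
- by move=> fX p /fX; exact/le_lt_trans/psum_comp_inj.
Qed.

Lemma psum_split p f N : psum p f =
  ((\sum_(0 <= n < N) normc (f n) `^ p)%:E +
   \sum_(N <= n <oo) (normc (f n) `^ p)%:E)%E.
Proof.
rewrite /psum (nneseries_split 0 N); last by move=> *; rewrite lee_fin powR_ge0.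
by rewrite add0n sumEFin.
Qed.

Lemma finsupp_lp p f N : 0 < p -> (forall n, (N <= n)%N -> f n = 0) -> lp p f.
Proof.
move=> p0 fN; rewrite /lp /= (psum_split _ _ N).
rewrite [X in (_ + X)%E]eseries0 ?adde0 ?ltry// => n Nn _.
by rewrite fN// normc0 powR0 ?gt_eqF.
Qed.

Lemma finsupp_carrier X f N : (forall n, (N <= n)%N -> f n = 0) -> carrier X f.
Proof.
move=> fN; have f0 : carrier Czero f.
  apply/CzeroP => e e0; apply: near_finite_nat; exists N => // n /= /fN ->.
  by rewrite normc0; apply/negP; rewrite -ltNge.
case: X => [||p p0|a a0] //; first exact: Czero_Linfty.
- exact: finsupp_lp fN.
- by move=> p /= ap; apply: finsupp_lp fN; exact: le_lt_trans ap.
Qed.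

(** * Linear operations, and combinations that avoid [X] *)

Lemma carrierD X a f g : carrier X f -> carrier X g -> carrier X (a *: f + g).
Proof.
move=> Xf Xg; have [_ /(_ a f g)] := carrier_closed X.
by rewrite !inE; apply.
Qed.

Lemma carrier0 X : carrier X 0.
Proof. by have [+ _] := carrier_closed X; rewrite inE. Qed.

Lemma carrierZ X a f : carrier X f -> carrier X (a *: f).
Proof.
by move=> Xf; rewrite -[_ *: _]addr0; apply: carrierD => //; exact: carrier0.
Qed.

Lemma carrierB X f g : carrier X f -> carrier X g -> carrier X (f - g).
Proof. by move=> Xf Xg; rewrite -scaleN1r addrC; exact: carrierD. Qed.

(* [comb M A w] is the combination with coefficients [A k n], [k < M], of the
   vectors [e_n + k.+1^-1 w_(k,n)], where [w_(k,n)] is the copy of [w] on the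
   set of all [pickle (k, n, j)]; this reading requires [A k n = 0] for
   [M <= k]. *)
Definition tens (A : nat -> nat -> R[i]) w : cseq R := fun i =>
  if pickle_inv i : option (nat * nat * nat) is Some (k, n, j)
  then k.+1%:R^-1 * A k n * w j else 0.

Definition comb M (A : nat -> nat -> R[i]) w : cseq R := fun i =>
  \sum_(k < M) A k i + tens A w i.

Lemma tens_pickle A w (k n j : nat) :
  tens A w (pickle (k, n, j)) = k.+1%:R^-1 * A k n * w j.
Proof. by rewrite /tens pickleK_inv. Qed.

Lemma comb_notin X w M A : ~ carrier X w ->
  (forall k n, (M <= k)%N || (M <= n)%N -> A k n = 0) ->
  carrier X (comb M A w) -> forall k n, A k n = 0.
Proof.
move=> Xw AM Xcomb k n; apply: contrapT => /eqP A0; apply: Xw.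
have Xt : carrier X (tens A w).
  (* The part along the vectors [e_n] vanishes from index [M] on, so it lies in [X] and can be
     subtracted. *)
  have := carrierB Xcomb (@finsupp_carrier X (fun i => \sum_(k < M) A k i) M _).
  rewrite [X in carrier _ X](_ : _ = tens A w); last first.
    by apply/funext => i; rewrite !fctE /comb addrC addKr.
  by apply => i Mi; rewrite big1// => j _; rewrite AM// Mi orbT.
have s_inj : injective (fun j : nat => pickle (k, n, j)).
  by move=> x y xy; have [] := pcan_inj pickleK_inv xy.
have := carrierZ (k.+1%:R^-1 * A k n)^-1 (carrier_comp_inj s_inj Xt).
congr carrier; apply/funext => j; rewrite !fctE /= tens_pickle.
by rewrite scalerA mulVf ?scale1r// mulf_neq0// invr_eq0 pnatr_eq0.
Qed.

(** * Balls of [lpmag] *)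

(** The p-th power and the p-th root are increasing and mutually inverse on nonnegative reals.
    Membership in [lp p] matters since [fine] sends [+oo] to 0. *)
Lemma lpmag_lt p f r : 0 < p -> lp p f -> 0 < r ->
  (lpmag p f < r) = (psum p f < (if 1 <= p then r `^ p else r)%:E)%E.
Proof.
move=> p0 fp r0; have := psum_ge0 p f; move: fp; rewrite /lp /lpmag /=.
case: (psum p f) => // s _; rewrite !lee_fin lte_fin /= => s0.
case: ifP => // _; have pi0 : 0 < p^-1 by rewrite invr_gt0.
have rK (x : R) : 0 <= x -> (x `^ p^-1) `^ p = x.
  by move=> x0; rewrite -powRrM mulVf ?gt_eqF// powRr1.
have rK' (x : R) : 0 <= x -> (x `^ p) `^ p^-1 = x.
  by move=> x0; rewrite -powRrM mulfV ?gt_eqF// powRr1.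
apply/idP/idP => [/(gt0_ltr_powR p0)|/(gt0_ltr_powR pi0)].
  by rewrite rK// !nnegrE powR_ge0 ltW//; apply.
by rewrite rK' ?ltW// !nnegrE powR_ge0 s0; apply.
Qed.

Lemma lpmag_small p e : 0 < p -> 0 < e ->
  exists2 d, 0 < d & forall f, lp p f -> lpmag p f < d -> (psum p f < e%:E)%E.
Proof.
move=> p0 e0; exists (if 1 <= p then e `^ p^-1 else e).
  by case: ifP => // _; rewrite powR_gt0.
move=> f fp; rewrite lpmag_lt//; last by case: ifP => // _; rewrite powR_gt0.
by have [p1|//] := boolP (1 <= p); rewrite -powRrM mulVf ?gt_eqF// powRr1// ltW.
Qed.

(* A substitute for the triangle inequality that covers all [p] at once:
   compare [normc y] with [d * normc x], where [1 + d = t `^ p^-1]. *)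
Lemma powR_normcD_le p (t : R) : 0 < p -> 1 < t ->
  exists2 C, 0 <= C & forall x y : R[i],
    normc (x + y) `^ p <= t * normc x `^ p + C * normc y `^ p.
Proof.
move=> p0 t1; pose u := t `^ p^-1; pose d := u - 1.
have t0 : 0 < t := lt_trans ltr01 t1.
have u0 : 0 <= u by exact: powR_ge0.
have ut : u `^ p = t by rewrite -powRrM mulVf ?gt_eqF// powRr1// ltW.
have d0 : 0 < d.
  rewrite subr_gt0 ltNge; apply/negP => u1.
  have := ge0_ler_powR (ltW p0) u0 ler01 u1.
  by rewrite ut powR1 leNgt t1.
(* This constant serves the case [d * normc x < normc y], where [normc (x + y)] is at most
   [normc y / d + normc y], that is [u / d * normc y]. *)
exists ((u / d) `^ p); first exact: powR_ge0.
move=> x y; have xyD := le_normcD x y.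
have [x0 y0] := (normc_ge0 x, normc_ge0 y).
have [yx|xy] := leP (normc y) (d * normc x).
  apply: (@le_trans _ _ (t * normc x `^ p)); last first.
    by rewrite lerDl mulr_ge0 ?powR_ge0.
  rewrite -ut -powRM//; apply: (ge0_ler_powR (ltW p0));
    rewrite ?nnegrE ?normc_ge0 ?mulr_ge0 ?invr_ge0 ?(ltW d0)//.
apply: (le_trans xyD); apply: (@le_trans _ _ (normc x + d * normc x)).
    by rewrite lerD2l.
  by rewrite -[X in X + _]mul1r -mulrDl addrC subrK.
apply: (@le_trans _ _ ((u / d) `^ p * normc y `^ p)); last first.
  by rewrite lerDr mulr_ge0 ?powR_ge0// ltW.
have ud0 : 0 <= u / d by rewrite divr_ge0// ltW.
rewrite -powRM//; apply: (ge0_ler_powR (ltW p0));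
    rewrite ?nnegrE ?normc_ge0 ?mulr_ge0 ?invr_ge0 ?(ltW d0)//.
apply: (le_trans xyD); apply: (@le_trans _ _ (normc y / d + normc y)).
  by rewrite lerD2r ler_pdivlMr// mulrC ltW.
rewrite [u in X in _ <= X](_ : u = 1 + d); last by rewrite addrC subrK.
by rewrite mulrDl mulfV ?gt_eqF// mul1r mulrDl mul1r mulrC.
Qed.

Lemma psumD_le p (t : R) : 0 < p -> 1 < t ->
  exists2 C, 0 <= C & forall f g,
    (psum p (f + g)%R <= t%:E * psum p f + C%:E * psum p g)%E.
Proof.
move=> p0 t1; have [C C0 DC] := powR_normcD_le p0 t1; exists C => // f g.
have t0 : 0 <= t := ltW (lt_trans ltr01 t1).
rewrite -!nneseriesZl; try by move=> *; rewrite lee_fin powR_ge0.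
rewrite -nneseriesD; try by move=> *; rewrite -EFinM lee_fin mulr_ge0 ?powR_ge0.
apply: lee_nneseries => n _ //; first by rewrite lee_fin powR_ge0.
by rewrite -!EFinM -EFinD lee_fin; exact: DC.
Qed.

(** Subbasic balls need not be centred at the limit of a sequence; this recentres them, using
    [psumD_le] with [t] close to 1. *)
Lemma lpmag_ball p g h r : 0 < p -> lp p (g - h) -> lpmag p (g - h) < r ->
  exists2 e, 0 < e &
    forall f, lp p (f - g) -> lp p (f - h) ->
      lpmag p (f - g) < e -> lpmag p (f - h) < r.
Proof.
move=> p0 ghp ghr; have r0 : 0 < r.
  apply: le_lt_trans ghr; rewrite /lpmag; case: ifP => _; first exact: powR_ge0.
  by rewrite fine_ge0// psum_ge0.
move: ghr; rewrite lpmag_lt//; set q := (if _ then _ else _).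
have := psum_ge0 p (g - h); move: ghp; rewrite /lp /=.
case Es : (psum p (g - h)) => [s| |]// _; rewrite lee_fin lte_fin => s0 sq.
have q0 : 0 < q := le_lt_trans s0 sq.
have qs0 : 0 < (q - s) / 2 by rewrite divr_gt0// subr_gt0.
(* The room [q - s] is split in two. The factor [t] adds less than one half to [s] because [s < q];
   the bound on [psum p (f - g)] keeps the [C] term within the other half, with [C + 1] as
   denominator since [C] may be 0. *)
have [C C0 DC] := @psumD_le p (1 + (q - s) / 2 / q) p0
  (ltac:(by rewrite ltrDl divr_gt0)).
have [e e0 eP] := @lpmag_small p ((q - s) / 2 / (C + 1)) p0
  (ltac:(by rewrite divr_gt0// ltr_wpDl)).
exists e => // f fg fh /(eP _ fg) fge; rewrite lpmag_lt// -/q.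
rewrite (_ : f - h = (g - h) + (f - g)); last by rewrite [RHS]addrC addrA subrK.
apply: (le_lt_trans (DC _ _)); rewrite Es -EFinM.
move: fge (psum_ge0 p (f - g)); case: (psum p (f - g)) => // z.
rewrite lte_fin lee_fin => ze z0; rewrite -EFinM -EFinD lte_fin.
have Cz : C * z <= (q - s) / 2.
  move: ze; rewrite ltr_pdivlMr ?ltr_wpDl// => /ltW; apply: le_trans.
  by rewrite mulrC ler_wpM2l// lerDl.
have sq2 : (q - s) / 2 / q * s < (q - s) / 2.
  by rewrite -mulrA gtr_pMr// mulrC ltr_pdivrMr// mul1r.
rewrite mulrDl mul1r.
rewrite [ltRHS](_ : q = s + (q - s) / 2 + (q - s) / 2); last first.
  by rewrite -addrA -splitr addrC subrK.
by rewrite ltr_leD// ltrD2l.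
Qed.

(** * Truncations and tensors in l^p *)

Lemma ge0_cvge0_near (a : nat -> \bar R) e :
  a n @[n --> \oo] --> 0%E -> 0 < e -> \forall n \near \oo, (a n < e%:E)%E.
Proof.
move=> a0 e0; have : nbhs (0 : \bar R)%E [set x | (x < e%:E)%E].
  apply: open_nbhs_nbhs; split; [|by rewrite /= lte_fin].
  exact: open_ereal_lt_ereal.
exact: a0.
Qed.

Definition trunc N f : cseq R := fun n => if (n < N)%N then f n else 0.

Lemma trunc_carrier X N f : carrier X (trunc N f).
Proof.
by apply: (@finsupp_carrier _ _ N) => n Nn; rewrite /trunc ltnNge Nn.
Qed.

Lemma psum_trunc p f e : 0 < p -> lp p f -> 0 < e ->
  \forall n \near \oo, (psum p (trunc n f - f)%R < e%:E)%E.
Proof.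
move=> p0 fp e0.
have := nneseries_tail_cvg fp (fun n _ => ltac:(by rewrite lee_fin powR_ge0)).
move/ge0_cvge0_near => /(_ _ e0); apply: filterS => N; apply: le_lt_trans.
(* The tail becomes a series over all indices, with zero terms below [N], and is compared
   termwise. *)
rewrite [leRHS]eseries_cond eseries_mkcond.
apply: lee_nneseries => n *; first by rewrite lee_fin powR_ge0.
rewrite !fctE /trunc ltnNge /=; case: (N <= n)%N => /=.
  by rewrite sub0r -scaleN1r normcM normcN normc1 mul1r.
by rewrite subrr normc0 powR0// gt_eqF.
Qed.

Lemma psumZ p (a : R[i]) f : psum p (a *: f) = ((normc a `^ p)%:E * psum p f)%E.
Proof.
rewrite -nneseriesZl; last by move=> *; rewrite lee_fin powR_ge0.
apply: eq_eseriesr => n _; rewrite -EFinM -powRM ?normc_ge0//.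
by rewrite !fctE normcM.
Qed.

(** Coefficients of the approximant of [f] at level [k]: for [k < M], [comb M] turns them into [f]
    plus an error carrying the factor [k.+1%:R^-1]. *)
Definition slice k f : nat -> nat -> R[i] := fun l n =>
  if l == k then f n else 0.

Lemma tens_slice k f w i : tens (slice k f) w i =
  if pickle_inv i is Some (l, n, j)
  then (if l == k then k.+1%:R^-1 * (f n * w j) else 0) else 0.
Proof.
rewrite /tens /slice; case: pickle_inv => // -[[l n] j].
by have [->|_] := eqVneq l k; rewrite ?mulrA// mulr0 mul0r.
Qed.

(** Apart from zeros, the entries are the products [k.+1%:R^-1 * f n * w j], one for each pair
    [(n, j)], so the double series factors. *)
Lemma psum_tens p k f w : 0 < p -> lp p w ->
  psum p (tens (slice k f) w) =
  (psum p w * ((normc (k.+1%:R^-1 : R[i]) `^ p)%:E * psum p f))%E.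
Proof.
move=> p0 wp; pose s (nj : nat * nat) := pickle (k, nj.1, nj.2).
have s_inj : set_inj setT s.
  by move=> [n j] [n' j'] _ _ /(pcan_inj pickleK_inv) [-> ->].
have -> : psum p (tens (slice k f) w) =
    \esum_(i in range s) (normc (tens (slice k f) w i) `^ p)%:E.
  rewrite psumE [RHS]esum_mkcond; apply: eq_esum => i _; case: ifPn => //.
  rewrite notin_setE => si; suff -> : tens (slice k f) w i = 0.
    by rewrite normc0 powR0// gt_eqF.
  (* An index outside the range of [s] encodes no triple, or one whose first entry differs from
     [k]. *)
  rewrite tens_slice; have := @pickle_invK (nat * nat * nat)%type i.
  case: pickle_inv => [[[l n] j]|//] /= ski; case: eqP => // lk.
  by case: si; exists (n, j); rewrite // /s -lk.
transitivity (\esum_(t in [set: nat * nat])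
  (normc (tens (slice k f) w (s t)) `^ p)%:E).
  exact: (esum_image [set: nat * nat] s
    (fun i => (normc (tens (slice k f) w i) `^ p)%:E)).
rewrite (_ : [set: nat * nat] = setT `*`` (fun=> setT)); last first.
  by apply/seteqP; split.
pose c : R[i] := k.+1%:R^-1.
(* Tonelli: the sum over pairs is an iterated sum, whose inner sum over [j] is a multiple of
   [psum p w]. *)
have := @esum_esum R nat nat setT (fun=> setT)
  (fun n j => (normc ((c * f n) * w j) `^ p)%:E)
  (fun n j _ _ => ltac:(by rewrite lee_fin powR_ge0)).
under [in RHS]eq_esum do [rewrite -mulrA].
rewrite [X in _ = X](_ : _ =
  \esum_(i in [set: nat] `*`` (fun=> [set: nat])) 
    (normc (tens (slice k f) w (s i)) `^ p)%:E); last first.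
  apply: eq_esum => -[n j] _; rewrite tens_slice pickleK_inv eqxx//.
move=> <-.
(* Finiteness of [psum p w] lets it leave the outer series as a real scalar. *)
have wE : (fine (psum p w))%:E = psum p w.
  by rewrite fineK// ge0_fin_numE// psum_ge0.
transitivity (\esum_(n in [set: nat])
  ((fine (psum p w))%:E * (normc (c * f n) `^ p)%:E)%E).
  by apply: eq_esum => n _; rewrite wE muleC -psumZ psumE.
rewrite -nneseries_esumT; last first.
  by move=> n; rewrite wE mule_ge0 ?psum_ge0// lee_fin powR_ge0.
by rewrite nneseriesZl ?wE -?psumZ// => *; rewrite lee_fin powR_ge0.
Qed.

Lemma normc_natV k : normc (k.+1%:R^-1 : R[i]) = k.+1%:R^-1.
Proof. by rewrite normcV normcMn normc1. Qed.

Lemma psum_tens_near p f w e : 0 < p -> lp p f -> lp p w -> 0 < e ->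
  \forall k \near \oo, (psum p (tens (slice k f) w) < e%:E)%E.
Proof.
move=> p0 fp wp e0; under eq_near do rewrite psum_tens// normc_natV.
move: (psum_ge0 p f) (psum_ge0 p w) fp wp; rewrite /lp /=.
case: (psum p f) => // s; case: (psum p w) => // t.
rewrite !lee_fin => s0 t0 _ _.
(* This is the threshold for [k.+1%:R^-1], whose p-th power gets multiplied by [t * s]; the [+ 1]
   covers [t * s = 0]. *)
have d0 : 0 < (e / (t * s + 1)) `^ p^-1.
  by rewrite powR_gt0// divr_gt0// ltr_wpDl// mulr_ge0.
have := near_infty_natSinv_lt (PosNum d0); apply: filterS => k /= ke.
rewrite -!EFinM lte_fin mulrCA.
have := gt0_ltr_powR p0 _ _ ke; rewrite !nnegrE invr_ge0 ler0n powR_ge0.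
move=> /(_ isT isT); rewrite -powRrM mulVf ?gt_eqF// powRr1; last first.
  by rewrite divr_ge0 ?addr_ge0 ?mulr_ge0// ltW.
rewrite ltr_pdivlMr; last by rewrite ltr_wpDl// mulr_ge0.
by apply: le_lt_trans; rewrite ler_wpM2l ?powR_ge0// lerDl.
Qed.

(** * Sup norm estimates, and membership of tensors *)

Lemma supnorm_le f (M : R) : (forall n, normc (f n) <= M) -> supnorm f <= M.
Proof.
move=> fM; apply: sup_le_ub; first by exists (normc (f 0%N)), 0%N.
by move=> _ [n _ <-].
Qed.

Lemma le_supnorm f n : carrier Linfty f -> normc (f n) <= supnorm f.
Proof. by move=> fM; apply: ub_le_sup => //; exists n. Qed.

Lemma supnorm_ball f g h r : carrier Linfty (g - h) -> carrier Linfty (f - g) ->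
  supnorm (f - g) < r - supnorm (g - h) -> supnorm (f - h) < r.
Proof.
move=> gh fg; rewrite ltrBrDr; apply: le_lt_trans; apply: supnorm_le => n.
rewrite (_ : f - h = (f - g) + (g - h)); last by rewrite addrA subrK.
by apply: (le_trans (le_normcD _ _)); rewrite lerD//; exact: le_supnorm.
Qed.

Lemma supnorm_trunc f e : carrier Czero f -> 0 < e ->
  \forall n \near \oo, supnorm (trunc n f - f) < e.
Proof.
(* Entries below [e / 2] bound the supremum by [e / 2]; the halving makes the final inequality
   strict. *)
move=> /CzeroP f0 e0; have e20 : 0 < e / 2 by rewrite divr_gt0.
have [N _ fN] := finite_nat_near (f0 _ e20); exists N => // n /= Nn.
apply: (@le_lt_trans _ _ (e / 2)); last first.
  by rewrite ltr_pdivrMr// ltr_pMr// ltr1n.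
apply: supnorm_le => j; rewrite !fctE /trunc; have [jn|nj] := ltnP j n.
  by rewrite subrr normc0 ltW.
rewrite sub0r -scaleN1r normcM normcN normc1 mul1r.
by have /negP := fN _ (leq_trans Nn nj); rewrite -ltNge => /ltW.
Qed.

Lemma normc_tens_le k f w (A B : R) i : (forall n, normc (f n) <= A) ->
  (forall n, normc (w n) <= B) ->
  normc (tens (slice k f) w i) <= k.+1%:R^-1 * (A * B).
Proof.
move=> fA wB; have A0 : 0 <= A := le_trans (normc_ge0 _) (fA 0%N).
have B0 : 0 <= B := le_trans (normc_ge0 _) (wB 0%N).
have r0 : normc (0 : R[i]) <= k.+1%:R^-1 * (A * B) by rewrite normc0 !mulr_ge0.
rewrite tens_slice; case: pickle_inv => // -[[l n] j]; case: ifP => // _.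
by rewrite !normcM normc_natV ler_wpM2l// ler_pM// normc_ge0.
Qed.

Lemma supnorm_tens f w e : carrier Linfty f -> carrier Linfty w -> 0 < e ->
  \forall k \near \oo, supnorm (tens (slice k f) w) < e.
Proof.
move=> fX wX e0.
have s0 g : carrier Linfty g -> 0 <= supnorm g.
  by move=> /(le_supnorm 0%N); apply: le_trans; exact: normc_ge0.
have f0 := s0 _ fX; have w0 := s0 _ wX.
have d0 : 0 < e / (supnorm f * supnorm w + 1).
  by rewrite divr_gt0// ltr_wpDl// mulr_ge0.
have := near_infty_natSinv_lt (PosNum d0); apply: filterS => k /= ke.
apply: (@le_lt_trans _ _ (k.+1%:R^-1 * (supnorm f * supnorm w))).
  by apply: supnorm_le => i; apply: normc_tens_le => n; exact: le_supnorm.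
move: ke; rewrite ltr_pdivlMr; last by rewrite ltr_wpDl// mulr_ge0.
by apply: le_lt_trans; rewrite ler_wpM2l// lerDl.
Qed.

Lemma tens_carrier X k f w N : carrier X f ->
  (forall n, (N <= n)%N -> f n = 0) -> carrier X w ->
  carrier X (tens (slice k f) w).
Proof.
have lp_tens p : 0 < p -> lp p f -> lp p w -> lp p (tens (slice k f) w).
  move=> p0 fp wp; rewrite /lp /= psum_tens//.
  by rewrite !lte_mul_pinfty ?mule_ge0 ?psum_ge0 ?lee_fin ?powR_ge0//
     ge0_fin_numE ?psum_ge0.
case: X => [||p p0|a a0] fX fN wX.
- move: fX wX => /LinftyP[A fA] /LinftyP[B wB]; apply/LinftyP.
  by exists (k.+1%:R^-1 * (A * B)) => i; exact: normc_tens_le.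
- apply/CzeroP => e e0.
  have /LinftyP[M fM] := Czero_Linfty fX.
  have M0 : 0 <= M := le_trans (normc_ge0 _) (fM 0%N).
  have eM : 0 < e / (M + 1) by rewrite divr_gt0// ltr_wpDl.
  (* An entry of modulus at least [e] has level [k] and [n < N], and [normc (f n) <= M] keeps [w j]
     away from 0: this leaves finitely many triples. *)
  have fin : finite_set
      ([set k] `*` `I_N `*` [set j | e / (M + 1) <= normc (w j)]).
    by apply: finite_setX; [exact: finite_setX|move/CzeroP : wX; apply].
  apply: (sub_finite_set _ (finite_image pickle fin)) => i /=.
  rewrite tens_slice; have := @pickle_invK (nat * nat * nat)%type i.
  have e00 : ~ e <= normc (0 : R[i]) by apply/negP; rewrite normc0 -ltNge.
  case: pickle_inv => [[[l n] j]|] //= <-; have [->|_ //] := eqVneq l k.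
  have [nN|/fN ->] := ltnP n N; last by rewrite mul0r mulr0.
  rewrite !normcM normc_natV => ewj; exists (k, n, j) => //; split => //=.
  rewrite ler_pdivrMr ?ltr_wpDl//; apply: (le_trans ewj).
  rewrite mulrC; apply: (@le_trans _ _ (normc (f n) * normc (w j))).
    by rewrite ler_piMr ?mulr_ge0 ?normc_ge0// invf_le1// ler1n.
  rewrite mulrC ler_wpM2l ?normc_ge0//; apply: (le_trans (fM n)).
  by rewrite lerDl.
- exact: lp_tens.
- by move=> p ap; apply: lp_tens; [exact: le_lt_trans ap|exact: fX|exact: wX].
Qed.

(** * Convergence and open sets in [Y] *)

(** Reduces each estimate to the sup norm on c_0 or to a single [lpmag p] on a space inside l^p;
    intersections are handled one exponent at a time. *)
Lemma magnitudes_lp Y (N : cseq R -> R) :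
  carrier Y <> carrier Linfty -> magnitudes Y N ->
  (Y = Czero /\ N = supnorm) \/
  exists p, [/\ 0 < p, N = lpmag p & forall f, carrier Y f -> lp p f].
Proof.
case: Y => [||p p0|a a0] YL => [|->|->|[p ap <-]].
- by case: YL.
- by left.
- by right; exists p.
- by right; exists p; split => //; [exact: le_lt_trans ap|move=> f; apply].
Qed.

(** Convergence of raw sequences, measured by magnitudes; [tends_to_open] links it to the topology
    of [seqspace Y]. *)
Definition tends_to Y (u : nat -> cseq R) g := forall N, magnitudes Y N ->
  forall e, 0 < e -> \forall n \near \oo, N (u n - g) < e.

Lemma tends_to_ball Y u g h r N : carrier Y <> carrier Linfty ->
  (forall n, carrier Y (u n)) -> carrier Y g -> carrier Y h ->
  tends_to Y u g -> magnitudes Y N -> N (g - h) < r ->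
  \forall n \near \oo, N (u n - h) < r.
Proof.
move=> YL uY gY hY ug YN; have [[YC NE]|[p [p0 NE Yp]]] := magnitudes_lp YL YN.
  rewrite YC NE {N NE YC} in uY gY hY ug YN * => ghr.
  have : 0 < r - supnorm (g - h) by rewrite subr_gt0.
  move=> /(ug _ YN); apply: filterS => n.
  by apply: supnorm_ball; apply: Czero_Linfty; exact: carrierB.
rewrite {}NE in YN * => ghr.
have [e e0 eP] := lpmag_ball p0 (Yp _ (carrierB gY hY)) ghr.
have := ug _ YN _ e0; apply: filterS => n.
by apply: eP; apply: Yp; exact: carrierB.
Qed.

Lemma lpmag_near p (u : nat -> cseq R) : 0 < p -> (forall n, lp p (u n)) ->
  (forall e, 0 < e -> \forall n \near \oo, (psum p (u n) < e%:E)%E) ->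
  forall e, 0 < e -> \forall n \near \oo, lpmag p (u n) < e.
Proof.
move=> p0 up psum_u e e0; under eq_near do rewrite lpmag_lt//.
by apply: psum_u; case: ifP => // _; exact: powR_gt0.
Qed.

(** Tails tend to 0 in every space of the family except l^oo, whence the density of finitely
    supported sequences. *)
Lemma tends_to_trunc Y g : carrier Y <> carrier Linfty -> carrier Y g ->
  tends_to Y (trunc ^~ g) g.
Proof.
move=> YL gY N YN; have [[YC ->]|[p [p0 -> Yp]]] := magnitudes_lp YL YN.
  by rewrite YC in gY => e; exact: supnorm_trunc.
apply: lpmag_near => // [n|e].
  by apply: Yp; apply: carrierB => //; exact: trunc_carrier.
by apply: psum_trunc => //; exact: Yp.
Qed.

Lemma tends_to_tens Y g f w n : carrier Y <> carrier Linfty ->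
  (forall k, (n <= k)%N -> f k = 0) -> carrier Y w ->
  tends_to Y (fun k => g + tens (slice k f) w) g.
Proof.
move=> YL fn wY N YN; have fY := finsupp_carrier Y fn.
have tE k : g + tens (slice k f) w - g = tens (slice k f) w.
  by rewrite addrC addKr.
have [[YC ->]|[p [p0 -> Yp]]] := magnitudes_lp YL YN.
  rewrite YC in fY wY => e e0; under eq_near do rewrite tE.
  by apply: supnorm_tens => //; exact: Czero_Linfty.
apply: lpmag_near => // [k|e e0]; rewrite ?tE.
  by apply: Yp; exact: tens_carrier fn wY.
by under eq_near do rewrite tE; apply: psum_tens_near => //; exact: Yp.
Qed.

(** An open set is a union of finite intersections of subbasic balls; one of these intersections
    contains [g], and each of its balls contains [u n] for all large [n]. *)
Lemma tends_to_open Y (u : nat -> seqspace Y) (g : seqspace Y)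
    (O : set (seqspace Y)) :
  carrier Y <> carrier Linfty -> tends_to Y (val \o u) (val g) ->
  open O -> O g -> exists n, O (u n).
Proof.
move=> YL ug [B BD <-] [/= b Bb bg].
have inY (f : seqspace Y) : carrier Y (val f) by have := valP f; rewrite inE.
suff : \forall n \near \oo, b (u n).
  by case=> N _ /(_ N (leqnn N)) bN; exists N, b.
have [I ID Ib] := BD _ Bb.
rewrite -Ib in bg *; apply: filter_bigI => -[[N h] r] iI.
have [/= YN r0] : magnitudes Y N /\ 0 < r by have := ID _ iI; rewrite inE.
by apply: (tends_to_ball YL _ _ _ ug YN) => [n|||];
  try exact: inY; exact: bg iI.
Qed.

(** * Algebra of the combinations, and the theorem *)

(** Brings two combinations to a common bound before they are added; the tensor part does not depend
    on the bound. *)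
Lemma comb_widen M M' A w :
  (forall k n, (M <= k)%N || (M <= n)%N -> A k n = 0) ->
  (M <= M')%N -> comb M' A w = comb M A w.
Proof.
move=> AM /subnKC <-; apply/funext => i; rewrite /comb big_split_ord /=.
by rewrite [X in _ + X + _]big1 ?addr0// => k _; rewrite AM// leq_addr.
Qed.

Lemma comb_linear M (a : R[i]) A B w :
  comb M (fun k n => a * A k n + B k n) w = a *: comb M A w + comb M B w.
Proof.
apply/funext => i; rewrite !fctE /comb big_split /= -mulr_sumr.
rewrite [X in _ = X + _]mulrDr addrACA; congr (_ + _).
rewrite /tens; case: pickle_inv => [[[k n] j]|]; last by rewrite mulr0 addr0.
by rewrite mulrDr mulrDl !mulrA (mulrC _ a).
Qed.

Lemma comb_slice M k f w : (k < M)%N ->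
  comb M (slice k f) w = f + tens (slice k f) w.
Proof.
move=> kM; apply/funext => i; rewrite !fctE /comb (bigD1 (Ordinal kM))//= big1.
  by rewrite addr0 /slice eqxx.
by move=> l; rewrite -val_eqE /slice => /= /negPf ->.
Qed.

End family.

Theorem proposition3 (R : realType) (X Y : space_name R) :
  carrier Y <> carrier Linfty ->
  carrier X `<=` carrier Y ->
  carrier X <> carrier Y ->
  exists F : set (seqspace Y),
    [/\ GRing.submod_closed [in F],
        dense F &
        forall f : seqspace Y, F f -> f <> 0 -> ~ carrier X (val f)].
Proof.
move=> YL XY neqXY.
have [w Yw Xw] : exists2 w, carrier Y w & ~ carrier X w.
  apply: contrapT => noW; apply: neqXY; apply/seteqP; split => // w Yw.
  by apply: contrapT => Xw; apply: noW; exists w.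
(* Coefficients vanishing outside a finite square make [F] a set of finite combinations. *)
pose fin M (A : nat -> nat -> R[i]) :=
  forall k n, (M <= k)%N || (M <= n)%N -> A k n = 0.
have finW M M' A : (M <= M')%N -> fin M A -> fin M' A.
  move=> MM' AM k n /orP[Mk|Mn]; apply: AM; apply/orP; [left|right];
  exact: leq_trans MM' _.
exists [set f | exists M A, fin M A /\ val f = comb M A w]; split.
- split=> [|a f g]; rewrite !inE.
    exists 0%N, (fun _ _ => 0); split=> //.
    apply/funext => i; rewrite /comb big_ord0 add0r /tens.
    by case: pickle_inv => // -[[k n] j]; rewrite mulr0 mul0r.
  move=> [M [A [AM fE]]] [M' [A' [AM' gE]]].
  have [MN MN'] := (leq_maxl M M', leq_maxr M M').
  exists (maxn M M'), (fun k n => a * A k n + A' k n); split.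
    by move=> k n kn; rewrite (finW _ _ _ MN AM)// (finW _ _ _ MN' AM')//
      mulr0 addr0.
  by rewrite comb_linear (comb_widen _ AM MN) (comb_widen _ AM' MN') -fE -gE.
- move=> O [g Og] openO.
  have inY (f : seqspace Y) : carrier Y (val f) by have := valP f; rewrite inE.
  pose mk f (Yf : carrier Y f) : seqspace Y :=
    exist (fun f => f \in in_space Y) f (mem_set Yf).
  (* Density takes two steps: [O] contains a truncation [t] of [g], and then, being open around [t],
     an approximant of [t] lying in [F]. *)
  have [n On] := tends_to_open (u := fun n => mk _ (trunc_carrier Y n (val g)))
    YL (tends_to_trunc YL (inY g)) openO Og.
  set t := trunc n (val g) in On.
  have t0 k : (n <= k)%N -> t k = 0 by move=> nk; rewrite /t /trunc ltnNge nk.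
  have Yt := finsupp_carrier Y t0.
  have Ytens k : carrier Y (t + tens (slice k t) w).
    have := carrierD 1 Yt (tens_carrier k Yt t0 Yw); rewrite scale1r; exact.
  have [k Ok] := tends_to_open (u := fun k => mk _ (Ytens k))
    (g := mk t (trunc_carrier Y n (val g)))
    YL (tends_to_tens t YL t0 Yw) openO On.
  (* The square must contain the level [k] and the support of [t], which lies below [n]. *)
  eexists; split; [exact: Ok|exists (maxn k.+1 n), (slice k t)]; split.
    move=> l m; rewrite !geq_max /slice; case: eqP => // ->.
    move=> /orP[/andP[]|/andP[_ /t0]//].
    by rewrite ltnn.
  by rewrite comb_slice// leq_maxl.
- move=> f [M [A [AM fE]]] fN0 Xf; apply: fN0; apply/val_inj; rewrite fE.
  have A0 : forall k n, A k n = 0 by apply: (comb_notin Xw AM); rewrite -fE.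
  apply/funext => i; rewrite /comb /tens big1 ?add0r//.
  by case: pickle_inv => // -[[k n] j]; rewrite A0 mulr0 mul0r.
Qed.
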